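(* Let $p$ be an odd prime, $q=p^f$ with $f\geq 1$, and let $G=G(q)$ be the pro-$p$ group of infinite upper unitriangular matrices over $\mathbb{F}_q$. Let $\alpha\in[0,1]$. Then there exists a partition subgroup $P_\mu$ of $G$ for which $\dim(P_\mu)=\alpha$. In particular $\operatorname{Spec}(G)=[0,1]$. Moreover, for all $d\geq 1$, $$\dim(\gamma_d(G))=\dim(G^{(d)})=1$$ for the subgroups of $G$ in the lower central and derived series of $G$.
   Context: $\mathbb{N}$ denotes the positive integers. For $n\in\mathbb{N}$, $G_n=G_n(q)$ is the group of $n\times n$ upper triangular matrices over $\mathbb{F}_q$ with all diagonal entries $1$. The maps $G_{n+1}\to G_n$ deleting the last row and column form an inverse system, and $G=\varprojlim_n G_n$ with its profinite topology; its elements are the matrices $(x_{ij})_{i,j\in\mathbb{N}}$ over $\mathbb{F}_q$ with $x_{ii}=1$ and $x_{ij}=0$ for $i>j$. Let $N_n$ be the kernel of $G\to G_n$. A partition diagram is a set $\mu\subseteq\{(i,j)\in\mathbb{N}^2: i<j\}$ such that $(i,j)\in\mu$ and $(j,k)\in\mu$ imply $(i,k)\in\mu$. The corresponding partition subgroup is $P_\mu=\{x\in G: x_{ij}=0 \text{ for all } i<j \text{ with } (i,j)\notin\mu\}$. Hausdorff dimension is taken with respect to the filtration $(N_n)$: for a closed subgroup $H$ of $G$, $\dim(H)=\lim_{n\to\infty}\frac{\log|HN_n/N_n|}{\log|G_n|}$ whenever the limit exists, and in general $\dim(H)\geq\liminf_{n\to\infty}\frac{\log|HN_n/N_n|}{\log|G_n|}$.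 (In general, for $M\subseteq G$ and Haar probability measure $m$ on $G$, $\dim(M)$ is the critical exponent $\Delta$ such that $l^\gamma(M)=\infty$ for $\gamma<\Delta$ and $l^\gamma(M)=0$ for $\gamma>\Delta$, where $l^\gamma(M)=\lim_{\theta\to0}\inf_{\mathcal C}\sum_{B\in\mathcal C}m(B)^\gamma$ and $\mathcal C$ runs over covers of $M$ by cosets $B$ of the subgroups $N_n$, $n\in\mathbb{N}$, with $m(B)<\theta$.) The Hausdorff spectrum is $\operatorname{Spec}(G)=\{\dim(H): H \text{ a closed subgroup of } G\}$. $\gamma_1(G)=G$, $\gamma_{d+1}(G)=[\gamma_d(G),G]$; $G^{(1)}=G$, $G^{(2)}=[G,G]$, and $G^{(d)}=[G^{(d-1)},G^{(d-1)}]$ for $d\geq 2$. *)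

(* Defs.v *)
From HB Require Import structures.
From mathcomp Require Import all_boot all_order all_algebra.
From mathcomp Require Import all_classical all_reals all_analysis.

Set Implicit Arguments.
Unset Strict Implicit.
Unset Printing Implicit Defensive.

Import Order.TTheory GRing.Theory Num.Theory.
Import numFieldNormedType.Exports.

Local Open Scope classical_set_scope.
Local Open Scope ring_scope.

(* Rows and columns are numbered from 0, so that index i here is index i + 1
   in the convention where matrices are indexed by the positive integers. *)
Record utmx (F : finFieldType) := UTmx {
  utfun :> nat -> nat -> F;
  utfun_diag : forall i, utfun i i = 1;
  utfun_lower : forall i j, (j < i)%N -> utfun i j = 0
}.

Lemma utmxP (F : finFieldType) (x y : utmx F) :
  (forall i j, x i j = y i j) -> x = y.
Proof.
case: x y => [x x1 x0] [y y1 y0] /= xy.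
have {}xy : x = y by apply/funext => i; apply/funext => j.
by subst y; congr UTmx; exact: Prop_irrelevance.
Qed.

HB.instance Definition _ (F : finFieldType) := gen_eqMixin (utmx F).
HB.instance Definition _ (F : finFieldType) := gen_choiceMixin (utmx F).

Section Group.
Variable F : finFieldType.
Implicit Types x y z : utmx F.

Definition ut1fun (i j : nat) : F := (i == j)%:R.

Lemma ut1_diag i : ut1fun i i = 1.
Proof. by rewrite /ut1fun eqxx. Qed.

Lemma ut1_lower i j : (j < i)%N -> ut1fun i j = 0.
Proof. by rewrite /ut1fun => /gtn_eqF ->. Qed.

Definition ut1 := UTmx ut1_diag ut1_lower.

(* The terms x i k * y k j of the matrix product with k > j vanish. *)
Definition utmulfun x y (i j : nat) : F := \sum_(k < j.+1) x i k * y k j.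

Lemma utmul_diag x y i : utmulfun x y i i = 1.
Proof.
rewrite /utmulfun big_ord_recr/= !utfun_diag mulr1 big1 ?add0r// => k _.
by rewrite utfun_lower ?mul0r.
Qed.

Lemma utmul_lower x y i j : (j < i)%N -> utmulfun x y i j = 0.
Proof.
move=> ji; rewrite /utmulfun big1// => k _.
by rewrite utfun_lower ?mul0r//; apply: leq_trans ji; rewrite ltnS -ltnS.
Qed.

Definition utmul x y := UTmx (utmul_diag x y) (utmul_lower x y).

Lemma utmul_widen x y i j n : (j < n)%N ->
  utmul x y i j = \sum_(k < n) x i k * y k j.
Proof.
move=> jn; rewrite /= /utmulfun (big_ord_widen n (fun k => x i k * y k j))//.
rewrite big_mkcond; apply: eq_bigr => k _; case: ifPn => //.
by rewrite -leqNgt => jk; rewrite (utfun_lower y) ?mulr0.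
Qed.

Lemma utmulA : associative utmul.
Proof.
move=> x y z; apply: utmxP => i j.
rewrite !(utmul_widen _ _ _ (ltnSn j)).
under eq_bigr => k _.
  rewrite (utmul_widen _ _ _ (ltnSn j)) mulr_sumr; over.
rewrite exchange_big; apply: eq_bigr => l _.
rewrite (utmul_widen _ _ _ (ltn_ord l)) mulr_suml.
by apply: eq_bigr => k _; rewrite mulrA.
Qed.

Lemma utmul1x : left_id ut1 utmul.
Proof.
move=> x; apply: utmxP => i j; have [ij|ji] := leqP i j; last first.
  by rewrite !utfun_lower.
rewrite /= /utmulfun (bigD1 (Ordinal (ij : (i < j.+1)%N)))//= ut1_diag mul1r.
rewrite big1 ?addr0// => k /eqP ki; rewrite /ut1fun; case: eqP => [e|]; last first.
  by rewrite mul0r.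
by case: ki; apply: val_inj.
Qed.

Lemma utmulx1 : right_id ut1 utmul.
Proof.
move=> x; apply: utmxP => i j; rewrite /= /utmulfun big_ord_recr/= ut1_diag mulr1.
by rewrite big1 ?add0r// => k _; rewrite /ut1fun ltn_eqF// mulr0.
Qed.

(* The inverse y of x solves y i j = (i == j) - \sum_(k < j) y i k * x k j. *)
Fixpoint utinv_iter x (t i j : nat) : F :=
  if t is t'.+1 then ut1fun i j - \sum_(k < j) utinv_iter x t' i k * x k j
  else 0.

Definition utinvfun x i j := utinv_iter x j.+1 i j.

Lemma utinv_iterE x t i j : (j < t)%N -> utinv_iter x t i j = utinvfun x i j.
Proof.
have iter_eq t1 t2 k : (k < t1)%N -> (k < t2)%N ->
    utinv_iter x t1 i k = utinv_iter x t2 i k.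
  elim: t1 t2 k => [|t1 IH] [|t2] k //= kt1 kt2.
  congr (_ - _); apply: eq_bigr => l _; congr (_ * _).
  by apply: IH; apply: leq_trans (ltn_ord l) _.
by move=> jt; apply: iter_eq.
Qed.

Lemma utinvfunE x i j :
  utinvfun x i j = ut1fun i j - \sum_(k < j) utinvfun x i k * x k j.
Proof.
rewrite {1}/utinvfun /=; congr (_ - _); apply: eq_bigr => k _.
by rewrite utinv_iterE.
Qed.

Lemma utinv_lower x i j : (j < i)%N -> utinvfun x i j = 0.
Proof.
elim/ltn_ind: j => j IH ji; rewrite utinvfunE ut1_lower// big1 ?subr0// => k _.
by rewrite IH ?mul0r// (ltn_trans _ ji).
Qed.

Lemma utinv_diag x i : utinvfun x i i = 1.
Proof.
rewrite utinvfunE ut1_diag big1 ?subr0// => k _.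
by rewrite utinv_lower ?mul0r.
Qed.

Definition utinv x := UTmx (utinv_diag x) (utinv_lower x).

Lemma utmulVx : left_inverse ut1 utinv utmul.
Proof.
move=> x; apply: utmxP => i j; rewrite /= /utmulfun big_ord_recr/= utfun_diag.
by rewrite mulr1 utinvfunE addrC subrK.
Qed.

Lemma utmulxV : right_inverse ut1 utinv utmul.
Proof.
move=> x; rewrite -[LHS]utmul1x -(utmulVx (utinv x)) -utmulA.
by rewrite (utmulA (utinv x)) utmulVx utmul1x.
Qed.

HB.instance Definition _ :=
  isGroup.Build (utmx F) utmulA utmul1x utmulx1 utmulVx utmulxV.

End Group.

HB.instance Definition _ (F : finFieldType) := isPointed.Build (utmx F) 1%g.

Definition trunc (F : finFieldType) (n : nat) (x : utmx F) : 'M[F]_n :=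
  \matrix_(i < n, j < n) x i j.

(* The inverse limit topology: the topology of G as a subspace of the product
   of the discrete spaces of n x n matrices. *)
HB.instance Definition _ (F : finFieldType) :=
  Topological.copy (utmx F)
    (initial_topology
      ((fun x n => trunc n x) :
         utmx F -> prod_topology (fun n => discrete_topology 'M[F]_n))).

Definition trunc_ker (F : finFieldType) (n : nat) : set (utmx F) :=
  [set x | trunc n x = 1%:M].

Definition lcoset (F : finFieldType) (x : utmx F) (A : set (utmx F)) :
    set (utmx F) :=
  [set (x * y)%g | y in A].

Definition is_subgroup (F : finFieldType) (H : set (utmx F)) : Prop :=
  group_closed (mem H).

Definition commg_group (F : finFieldType) (A B : set (utmx F)) : set (utmx F) :=
  smallest (@is_subgroup F) [set [~ x, y]%g | x in A & y in B].

(* Both series are indexed from 1, with first term the whole group. *)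
Definition lower_central (F : finFieldType) (d : nat) : set (utmx F) :=
  iter d.-1 (fun H => commg_group H [set: utmx F]) [set: utmx F].

Definition derived_series (F : finFieldType) (d : nat) : set (utmx F) :=
  iter d.-1 (fun H => commg_group H H) [set: utmx F].

Definition partition_diagram (mu : set (nat * nat)) : Prop :=
  (forall i j, mu (i, j) -> (i < j)%N) /\
  (forall i j k, mu (i, j) -> mu (j, k) -> mu (i, k)).

Definition partition_subgroup (F : finFieldType) (mu : set (nat * nat)) :
    set (utmx F) :=
  [set x | forall i j, (i < j)%N -> ~ mu (i, j) -> x i j = 0].

Definition borel_utmx (F : finFieldType) := g_sigma_algebraType (@open (utmx F)).

Definition is_haar (F : finFieldType) (R : realType)
    (m : probability (borel_utmx F) R) : Prop :=
  forall (x : utmx F) (A : set (utmx F)),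
    measurable (A : set (borel_utmx F)) -> m (lcoset x A) = m A.

Section HausdorffDimension.
Variables (F : finFieldType) (R : realType) (m : probability (borel_utmx F) R).
Implicit Types (M : set (utmx F)) (C : set (set (utmx F))) (g theta : R).

Definition is_coset (B : set (utmx F)) : Prop :=
  exists n x, (0 < n)%N /\ B = lcoset x (@trunc_ker F n).

Definition is_cover M theta C : Prop :=
  [/\ forall B, C B -> is_coset B,
      forall B, C B -> (m B < theta%:E)%E &
      M `<=` \bigcup_(B in C) B].

Definition hausdorff_pre g M theta : \bar R :=
  ereal_inf [set \esum_(B in C) poweR (m B) g | C in is_cover M theta].

Definition hausdorff_l g M : \bar R :=
  lim (hausdorff_pre g M theta @[theta --> 0^'+]).

Definition has_dim M (Delta : R) : Prop :=
  (forall g, g < Delta -> hausdorff_l g M = +oo%E) /\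
  (forall g, Delta < g -> hausdorff_l g M = 0%E).

Definition Spec : set R :=
  [set a | exists H, [/\ is_subgroup H, closed H & has_dim H a]].

End HausdorffDimension.

(* Main.v *)
(* Write a_n for the number of positions (i, j) of mu with i < j < n; the image of P_mu in G_n has
   q^a_n elements, against q^'C(n, 2) for G_n. If a_n = alpha 'C(n, 2) + O(n), then covering P_mu
   by cosets of N_n bounds its dimension above by alpha, and a coset of N_n carries at most the mass
   q^-a_n of the push-forward of m under erasing the entries outside mu, which bounds it below.
   A diagram made of full columns is transitive, and choosing the columns greedily gives every
   density alpha. Finally, for d, e >= 1, conjugating 1 + J^e, with J the shift, by matrices
   vanishing on the first d - 1 superdiagonals yields all commutators needed to fill the partition
   subgroup of {(i, j) | i + d + e <= j}; hence each term of both series contains such a band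
   subgroup, whose dimension is 1. *)
Require Import Defs.
From mathcomp Require Import all_boot all_order all_algebra.
From mathcomp Require Import all_classical all_reals all_analysis.
From mathcomp Require Import zify ring lra.

Set Implicit Arguments.
Unset Strict Implicit.
Unset Printing Implicit Defensive.

Import Order.TTheory GRing.Theory Num.Theory.
Import numFieldNormedType.Exports.

Local Open Scope classical_set_scope.
Local Open Scope ring_scope.

(** * Truncations, their fibers, and the topology and group law of partition subgroups *)

Section Truncation.
Variable F : finFieldType.
Implicit Types (x y : utmx F) (g : nat -> nat -> F) (mu : set (nat * nat)).

Definition unitri_fun g (i j : nat) : F := if (i < j)%N then g i j else (i == j)%:R.

Lemma unitri_fun_diag g i : unitri_fun g i i = 1.
Proof. by rewrite /unitri_fun ltnn eqxx. Qed.

Lemma unitri_fun_lower g i j : (j < i)%N -> unitri_fun g i j = 0.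
Proof. by move=> ji; rewrite /unitri_fun ltnNge (ltnW ji)/= (gtn_eqF ji). Qed.

Definition unitri g : utmx F := UTmx (unitri_fun_diag g) (unitri_fun_lower g).

Definition cylinder n (A : 'M[F]_n) : set (utmx F) := [set x | trunc n x = A].

Lemma utmulE x y i j : (x * y)%g i j = \sum_(k < j.+1) x i k * y k j.
Proof. by []. Qed.

Lemma truncM n x y : trunc n (x * y)%g = trunc n x *m trunc n y.
Proof.
apply/matrixP => i j; rewrite !mxE (utmul_widen _ _ _ (ltn_ord j)).
by apply: eq_bigr => k _; rewrite !mxE.
Qed.

Lemma trunc1 n : trunc n (1%g : utmx F) = 1%:M.
Proof. by apply/matrixP => i j; rewrite !mxE. Qed.

Lemma lcoset_trunc_ker n x : lcoset x (@trunc_ker F n) = cylinder (trunc n x).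
Proof.
apply/seteqP; split => [_ [y yN <-]|y xy].
  by rewrite /cylinder/= truncM yN mulmx1.
exists (x^-1 * y)%g; last by rewrite mulgA mulgV mul1g.
by rewrite /trunc_ker/= truncM xy -truncM mulVg trunc1.
Qed.

Definition diag_positions n mu : {set 'I_n * 'I_n} :=
  [set ij : 'I_n * 'I_n | (ij.1 < ij.2)%N && `[< mu (val ij.1, val ij.2) >]].

Definition upper_positions n : {set 'I_n * 'I_n} := [set ij : 'I_n * 'I_n | (ij.1 < ij.2)%N].

Lemma diag_positions_sub n mu : diag_positions n mu \subset upper_positions n.
Proof. by apply/fintype.subsetP => ij; rewrite !inE => /andP[]. Qed.

(** Serves twice: with [D] the positions in [mu] it records what erasing the entries outside [mu]
    leaves visible; with [D] the positions outside [mu] and [A] the identity it is the image of the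
    partition subgroup in G_n. *)
Definition fiber n (D : {set 'I_n * 'I_n}) (A : 'M[F]_n) : {set 'M[F]_n} :=
  [set B : 'M[F]_n |
    [forall i : 'I_n, forall j : 'I_n, (i < j)%N || (B i j == (i == j)%:R)] &&
    [forall ij in D, B ij.1 ij.2 == A ij.1 ij.2]].

(** The entries above the diagonal and outside [D] are free, all others are forced; [h] reads the
    free ones from a function supported there. *)
Lemma card_fiber n (D : {set 'I_n * 'I_n}) (A : 'M[F]_n) :
  D \subset upper_positions n ->
  #|fiber D A| = (#|F| ^ (#|upper_positions n| - #|D|))%N.
Proof.
move=> DU; rewrite -(cardsDS DU) -(@card_pffun_on _ _ 0%R).
pose h (phi : {ffun 'I_n * 'I_n -> F}) : 'M[F]_n := \matrix_(i, j)
  if (i < j)%N then if (i, j) \in D then A i j else phi (i, j) else (i == j)%:R.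
have -> : fiber D A = [set h phi | phi in pffun_on 0%R (upper_positions n :\: D) predT]%SET.
  apply/finset.setP => B; apply/idP/imsetP => [|[phi _ ->]]; rewrite !inE.
    move=> /andP[/forallP tB /forall_inP BA].
    exists [ffun ij => if ij \in upper_positions n :\: D then B ij.1 ij.2 else 0].
      apply/pffun_onP; split=> //.
      by apply/supportP => ij /negbTE ijD; rewrite ffunE ijD.
    apply/matrixP => i j; rewrite !mxE; case: ifPn => ij.
      case: ifPn => ijD; first exact/eqP/(BA (i, j) ijD).
      by rewrite ffunE !inE ij ijD.
    by move: (tB i) => /forallP/(_ j); rewrite (negbTE ij) => /eqP.
  apply/andP; split.
    by apply/forallP => i; apply/forallP => j; rewrite mxE; case: (i < j)%N => /=.
  apply/forall_inP => -[i j] ijD; rewrite mxE/= ijD.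
  by move: (fintype.subsetP DU _ ijD); rewrite inE/= => ->.
rewrite card_in_imset// => phi psi /pffun_onP[/supportP phi0 _] /pffun_onP[/supportP psi0 _].
move=> /matrixP hh; apply/ffunP => -[i j].
have [|ijN] := boolP ((i, j) \in upper_positions n :\: D); last by rewrite phi0// psi0.
by rewrite !inE/= => /andP[ijD ij]; move: (hh i j); rewrite !mxE ij (negbTE ijD).
Qed.

Lemma trunc_fiber n mu x (A : 'M[F]_n) :
  trunc n x \in fiber (diag_positions n mu) A <->
  (forall i j : 'I_n, (i < j)%N -> mu (val i, val j) -> x i j = A i j).
Proof.
rewrite inE; split=> [/andP[_ /forall_inP xA] i j ij muij|xA].
  have /xA : (i, j) \in diag_positions n mu by rewrite inE/= ij; apply/asboolP.
  by rewrite mxE => /eqP.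
apply/andP; split.
  apply/forallP => i; apply/forallP => j; rewrite mxE; case: (ltngtP i j) => //= ij.
    by rewrite utfun_lower// -val_eqE/= (gtn_eqF ij).
  by rewrite -val_eqE/= ij eqxx utfun_diag.
by apply/forall_inP => -[i j]; rewrite inE mxE/= => /andP[ij /asboolP muij]; rewrite xA.
Qed.

Lemma fiber_trunc n (D : {set 'I_n * 'I_n}) (A B : 'M[F]_n) :
  B \in fiber D A -> exists x, trunc n x = B.
Proof.
rewrite inE => /andP[/forallP tB _].
exists (unitri (fun i j =>
  if (insub i, insub j) is (Some i', Some j') then B i' j' else 0)).
apply/matrixP => i j; rewrite mxE/= /unitri_fun !valK; case: ifPn => // ij.
by move: (tB i) => /forallP/(_ j); rewrite (negbTE ij) => /eqP.
Qed.

Lemma finite_cylinders n : finite_set (range (@cylinder n)).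
Proof. exact: finite_image. Qed.

(** Each level has finitely many cosets. Countability gives access to subadditivity of the measure
    over a cover. *)
Lemma countable_cosets : countable (@is_coset F).
Proof.
apply: (@sub_countable _ _ _ (\bigcup_n range (@cylinder n))).
  apply: subset_card_le => B [n [x [_ ->]]].
  by exists n => //; rewrite lcoset_trunc_ker; exists (trunc n x).
by apply: bigcup_countable => // n _; exact/finite_set_countable/finite_cylinders.
Qed.

Lemma open_trunc n (S : set 'M[F]_n) : open [set x : utmx F | S (trunc n x)].
Proof.
pose t : utmx F -> prod_topology (fun n => discrete_topology 'M[F]_n) :=
  fun x n => trunc n x.
have ct : continuous (proj n \o t : utmx F -> discrete_topology 'M[F]_n).
  move=> x; apply: continuous_comp; first exact: initial_continuous.
  exact: proj_continuous.
have -> : [set x : utmx F | S (trunc n x)] = (proj n \o t) @^-1` S by [].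
by move/continuousP : ct; apply; exact: discrete_open.
Qed.

Lemma closed_trunc n (S : set 'M[F]_n) : closed [set x : utmx F | S (trunc n x)].
Proof. by rewrite -[X in closed X]setCK; apply: open_closedC; exact: (open_trunc (~` S)). Qed.

Lemma measurable_trunc n (S : set 'M[F]_n) :
  measurable ([set x : utmx F | S (trunc n x)] : set (borel_utmx F)).
Proof. by apply: sub_sigma_algebra; exact: open_trunc. Qed.

Lemma partition_subgroup_closed mu : closed (@partition_subgroup F mu).
Proof.
have -> : @partition_subgroup F mu = \bigcap_n [set x : utmx F |
    [set A : 'M[F]_n | forall i j : 'I_n, (i < j)%N -> ~ mu (val i, val j) -> A i j = 0]
      (trunc n x)].
  apply/seteqP; split => [x xP n _ i j ij muij|x xP i j ij muij].
    by rewrite mxE xP.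
  have := xP j.+1 I (Ordinal (ltnW ij : (i < j.+1)%N)) ord_max ij muij.
  by rewrite mxE.
by apply: closed_bigI => n _; exact: closed_trunc.
Qed.

(** A nonzero term [x i k * y k j] with i < k < j needs (i, k) and (k, j) in [mu], hence (i, j) in
    [mu]. For inverses the same argument runs through the recursion [utinvfunE], by induction on the
    column. *)
Lemma partition_subgroup_group mu :
  partition_diagram mu -> is_subgroup (@partition_subgroup F mu).
Proof.
move=> [_ mu_trans].
split.
  by rewrite inE => i j ij _; rewrite /= /ut1fun (ltn_eqF ij).
move=> x y; rewrite !inE => xP yP.
suff [PM PV] : (forall x y, @partition_subgroup F mu x -> partition_subgroup mu y ->
      partition_subgroup mu (x * y)%g) /\
    (forall x, @partition_subgroup F mu x -> partition_subgroup mu x^-1%g).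
  by apply: PM => //; exact: PV.
split=> {x y xP yP} [x y xP yP i j ij muij|x xP i].
  rewrite utmulE big1// => k _.
  have [ki|ik|ki] := ltngtP k i; first by rewrite utfun_lower// mul0r.
    have [kj|jk|kj] := ltngtP k j; last by rewrite kj xP// mul0r.
      have [ikmu|ikmu] := pselect (mu (i, val k)); last by rewrite xP// mul0r.
      by rewrite yP ?mulr0// => kjmu; apply/muij/mu_trans/kjmu.
    by rewrite (utfun_lower y)// mulr0.
  by rewrite ki yP ?mulr0.
elim/ltn_ind => j IH ij muij.
have -> : (x^-1)%g i j = utinvfun x i j by [].
rewrite utinvfunE /ut1fun (ltn_eqF ij) big1 ?subr0// => k _.
have -> : utinvfun x i k = (x^-1)%g i k by [].
have [ki|ik|ki] := ltngtP k i; first by rewrite utfun_lower// mul0r.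
  have [ikmu|ikmu] := pselect (mu (i, val k)); last by rewrite IH// mul0r.
  by rewrite xP ?mulr0// => kjmu; apply/muij/mu_trans/kjmu.
by rewrite ki xP ?mulr0.
Qed.

End Truncation.

(** * Band subgroups inside the lower central and derived series *)

Definition band (d : nat) : set (nat * nat) := [set ij | (ij.1 + d <= ij.2)%N].

Section Commutators.
Variable F : finFieldType.
Implicit Types (x y : utmx F) (A B : set (utmx F)).

(* With J the matrix with ones on the e-th superdiagonal and s := 1 + J, the equation
   s * y = y * (s * x) reads J * y = y * J + (y + y * J) * (x - 1): it gives the row i + e of y
   in terms of the row i. The first e rows of y are those of the identity. *)
Fixpoint conj_row (e : nat) x (t i j : nat) : F :=
  if t is t'.+1 then
    let r := conj_row e x t' (i - e) in
    let rJ k := if (e <= k)%N then r (k - e)%N else 0 in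
    rJ j + \sum_(k < j) (r k + rJ k) * x k j
  else (i == j)%:R.

(** Solving [s * y = y * (s * x)] for [y] makes [x] a single commutator, so it is already a
    generator of the commutator subgroup. *)
Lemma band_commutator d e x : (0 < d)%N -> (0 < e)%N ->
  partition_subgroup (band (d + e)) x ->
  exists s y, [/\ partition_subgroup (band e) s, partition_subgroup (band d) y &
    x = [~ s, y]%g].
Proof.
move=> d0 e0 xP.
(* Exactly [i %/ e] steps of length [e] lead from row [i] back to one of the first [e] rows. *)
pose yf i j := conj_row e x (i %/ e) i j.
pose yJ i k := if (e <= k)%N then yf i (k - e)%N else 0.
have yfS i j : yf (i + e)%N j = yJ i j + \sum_(k < j) (yf i k + yJ i k) * x k j.
  by rewrite {1}/yf divnDr ?dvdnn// divnn e0 addn1 /= addnK.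
have yf_band i j : (j < i + d)%N -> yf i j = (i == j)%:R.
  elim/ltn_ind: i j => i IH j; have [ie _|ei] := ltnP i e.
    by rewrite /yf divn_small.
  rewrite -(subnK ei) yfS in IH *; move: (i - e)%N IH => {ei}i' IH ji.
  have i'i : (i' < i' + e)%N by lia.
  rewrite big1 ?addr0 => [|k _].
    rewrite /yJ; case: leqP => [ej|je]; last first.
      by rewrite gtn_eqF// (leq_trans je)// leq_addl.
    by rewrite IH// ?ltn_subLR//; [congr (_%:R); congr nat_of_bool; lia | lia].
  (* If j < k + (d + e), then [x k j] vanishes; otherwise k < i', and both entries of [y] in the
     term lie below the diagonal. *)
  have [kj|jk] := ltnP j (k + (d + e)); last first.
    rewrite /yJ IH//; last by lia.
    rewrite gtn_eqF; last by lia.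
    case: ifP => [ek|_]; last by rewrite addr0 mul0r.
    by rewrite IH//; [rewrite gtn_eqF ?addr0 ?mul0r//; lia | lia].
  by rewrite xP ?mulr0// => /=; apply/negP; rewrite -ltnNge.
have yf_diag i : yf i i = 1 by rewrite yf_band ?eqxx// -[ltnLHS]addn0 ltn_add2l.
have yf_lower i j : (j < i)%N -> yf i j = 0.
  by move=> ji; rewrite yf_band ?gtn_eqF// (leq_trans ji)// leq_addr.
pose y := UTmx yf_diag yf_lower.
pose s := @unitri F (fun i j => (j == i + e)%N%:R).
have sE i j : s i j = (i == j)%:R + (j == i + e)%N%:R.
  rewrite /s /= /unitri_fun; case: ltnP => ij; first by rewrite (ltn_eqF ij) add0r.
  by rewrite (@ltn_eqF j) ?addr0//; lia.
exists s, y; split.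
- move=> i j ij; rewrite sE (ltn_eqF ij) add0r; case: eqP => // -> [].
  exact: leqnn.
- by move=> i j ij /negP; rewrite -ltnNge => jid; rewrite /= yf_band ?(ltn_eqF ij).
suff sy : (s * y = y * (s * x))%g.
  by rewrite commgEl conjgE sy !mulKg.
apply: utmxP => i j; rewrite mulgA.
(* Right multiplication by [s] adds to each row its shift by [e] columns. *)
have ysE k : (y * s)%g i k = yf i k + yJ i k.
  rewrite utmulE.
  under eq_bigr => l _ do rewrite sE mulrDr.
  rewrite big_split/=; congr (_ + _).
    rewrite big_ord_recr/= eqxx mulr1 big1 ?add0r// => l _.
    by rewrite (ltn_eqF (ltn_ord l)) mulr0.
  rewrite /yJ; case: leqP => [ek|ke]; last first.
    by rewrite big1// => l _; rewrite ltn_eqF ?mulr0// (leq_trans ke)// leq_addl.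
  have kek : (k - e < k.+1)%N by rewrite ltnS leq_subr.
  rewrite (bigD1 (Ordinal kek))//= subnK// eqxx mulr1 big1 ?addr0// => l lk.
  case: eqP => [kl|]; last by rewrite mulr0.
  by case/eqP: lk; apply: val_inj => /=; lia.
rewrite [in RHS]utmulE big_ord_recr/= utfun_diag mulr1.
under eq_bigr => k _ do rewrite -[X in X * _]/((y * s)%g i k) ysE.
rewrite -[X in _ = _ + X]/((y * s)%g i j) ysE addrC -addrA -yfS.
(* The right side is now the sum of the entries of [y] in rows [i] and [i + e]. The product on the
   left is widened so that its sum reaches the index [i + e], which may exceed [j]. *)
have jn : (j < (i + e + j).+1)%N by rewrite ltnS leq_addl.
have -> : utmulfun s y i j = utmul s y i j by [].
rewrite (utmul_widen _ _ _ jn).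
under eq_bigr => k _ do rewrite sE mulrDl.
have pick_row a : (a < (i + e + j).+1)%N ->
    \sum_(k < (i + e + j).+1) (a == k)%:R * y k j = yf a j.
  move=> an; rewrite (bigD1 (Ordinal an))//= eqxx mul1r big1 ?addr0// => k ka.
  case: eqP => [ak|]; last by rewrite mul0r.
  by case/eqP: ka; apply: val_inj.
rewrite big_split/= pick_row; last by lia.
congr (_ + _); rewrite -[RHS]pick_row; last by lia.
by apply: eq_bigr => k _; rewrite eq_sym.
Qed.

Lemma commg_group_band d e A B : (0 < d)%N -> (0 < e)%N ->
  @partition_subgroup F (band d) `<=` A -> @partition_subgroup F (band e) `<=` B ->
  @partition_subgroup F (band (d + e)) `<=` commg_group A B.
Proof.
move=> d0 e0 dA eB x; rewrite addnC => /band_commutator.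
move=> /(_ e0 d0)[s [y [/dA sA /eB yB ->]]] H [_ HAB].
by apply: HAB; exists s => //; exists y.
Qed.

Lemma lower_central_band d : (0 < d)%N ->
  @partition_subgroup F (band d) `<=` @lower_central F d.
Proof.
case: d => // d _; elim: d => [//|d IH].
by rewrite -[X in band X]addn1; apply: (@commg_group_band d.+1 1 (@lower_central F d.+1) setT).
Qed.

(** Commuting a term with itself doubles the band width, which starts at 1. *)
Lemma derived_series_band d : (0 < d)%N ->
  @partition_subgroup F (band (2 ^ d.-1)) `<=` @derived_series F d.
Proof.
case: d => // d _; elim: d => [//|d IH].
rewrite expnS mul2n -addnn.
by apply: (@commg_group_band (2 ^ d) (2 ^ d) (@derived_series F d.+1) (@derived_series F d.+1)) => //; rewrite expn_gt0.
Qed.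

End Commutators.

(** * Counting the positions of a diagram *)

Section Counting.
Local Open Scope nat_scope.

Lemma card_diag_positions n (mu : set (nat * nat)) :
  #|diag_positions n mu| = \sum_(j < n) \sum_(i < j) `[< mu (val i, val j) >].
Proof.
rewrite -sum1_card big_mkcond.
transitivity (\sum_(i < n) \sum_(j < n) ((i, j) \in diag_positions n mu)).
  by rewrite pair_bigA; apply: eq_bigr => -[i j] _; case: ifP.
rewrite exchange_big; apply: eq_bigr => j _.
rewrite (big_ord_widen n (fun i => nat_of_bool `[< mu (i, val j) >]) (ltnW (ltn_ord j))).
rewrite [RHS]big_mkcond; apply: eq_bigr => i _.
by rewrite inE/=; case: (i < j)%N; case: (`[< _ >]).
Qed.

Lemma upper_positionsE n : upper_positions n = diag_positions n setT.
Proof. by apply/finset.setP => ij; rewrite !inE asboolT// andbT. Qed.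

Lemma card_upper_positions n : #|upper_positions n| = 'C(n, 2).
Proof.
rewrite upper_positionsE card_diag_positions -bin2_sum big_mkord.
apply: eq_bigr => j _; rewrite -[RHS]card_ord -sum1_card.
by apply: eq_bigr => i _; rewrite asboolT.
Qed.

(** Each column misses at most [d] positions of the band, so the defect is only linear in [n]. *)
Lemma card_band d n : 'C(n, 2) <= #|diag_positions n (band d)| + d * n.
Proof.
rewrite card_diag_positions -bin2_sum big_mkord.
rewrite -[X in _ + d * X]card_ord mulnC -sum_nat_const -big_split/=.
apply: leq_sum => j _.
suff: val j - d <= \sum_(i < j) `[< band d (val i, val j) >] by rewrite addnC -leq_subLR.
rewrite -[X in X <= _]card_ord -sum1_card (big_ord_widen j (fun=> 1) (leq_subr d j)).
rewrite big_mkcond; apply: leq_sum => i _; case: ltnP => // ij.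
by rewrite asboolT// /band/=; lia.
Qed.

End Counting.

(** * Diagrams of prescribed density *)

Section Greedy.
Variables (R : realType) (alpha : R).

Fixpoint greedy_total n : nat :=
  if n is n'.+1 then
    (greedy_total n' +
      (if ((greedy_total n')%:R <= alpha * 'C(n', 2)%:R)%R then n' else 0))%N
  else 0.

Definition greedy_diagram : set (nat * nat) :=
  [set ij | (ij.1 < ij.2)%N &&
     ((greedy_total ij.2)%:R <= alpha * 'C(ij.2, 2)%:R)].

(** Above the diagonal, membership depends on the column only, so (j, k) passes it on to (i, k). *)
Lemma greedy_diagram_partition : partition_diagram greedy_diagram.
Proof.
split=> [i j /andP[]//|i j k /andP[/= ij _] /andP[/= jk ok]].
by apply/andP; split; first exact: ltn_trans jk.
Qed.

Lemma card_greedy_diagram n :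
  #|diag_positions n greedy_diagram| = greedy_total n.
Proof.
rewrite card_diag_positions; elim: n => [|n IH]; first by rewrite big_ord0.
rewrite big_ord_recr/= IH; congr (_ + _)%N; case: ifP => ok.
  rewrite -[RHS]card_ord -sum1_card; apply: eq_bigr => i _.
  by rewrite asboolT// /greedy_diagram/= ok ltn_ord.
by rewrite big1// => i _; rewrite asboolF// /greedy_diagram/= ok andbF.
Qed.

(** Column [n] changes the error by (1 - alpha) n if the error is at most 0 and by - alpha n
    otherwise. The change points against the sign of the error and has size at most [n]. *)
Lemma greedy_total_approx n : 0 <= alpha <= 1 ->
  `|(greedy_total n)%:R - alpha * 'C(n, 2)%:R| <= n%:R.
Proof.
move=> /andP[a0 a1]; elim: n => [|n]; first by rewrite bin0n mulr0 subrr normr0.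
rewrite /= binS bin1 !natrD -natr1 !ler_norml => /andP[lo hi].
have n0 : 0 <= n%:R :> R by [].
by case: (lerP (greedy_total n)%:R (alpha * 'C(n, 2)%:R)) => h;
  apply/andP; split; nra.
Qed.

End Greedy.

(** * Haar measure of fibers and cosets *)

Section Measure.
Variables (F : finFieldType) (R : realType) (m : probability (borel_utmx F) R).
Hypothesis m_haar : is_haar m.

Let q : R := #|F|%:R.

Let q_gt1 : 1 < q.
Proof. by rewrite ltr1n card_finNzRing_gt1. Qed.

(** The set is a disjoint union of cosets of the kernel, one for each element of [S], all of equal
    mass; the hypothesis excludes empty cylinders. *)
Lemma measure_trunc n (S : {set 'M[F]_n}) :
  (forall B, B \in S -> exists x, trunc n x = B) ->
  m [set x | trunc n x \in S] = (#|S|%:R * fine (m (@trunc_ker F n)))%:E.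
Proof.
move=> Strunc.
have -> : [set x | trunc n x \in S] = \bigcup_(B in [set` S]) (@cylinder F n B).
  by apply/seteqP; split => [x xS|x [B BS xB]]; [exists (trunc n x)|rewrite /= xB].
have mcyl B : measurable (@cylinder F n B : set (borel_utmx F)).
  exact: (@measurable_trunc F n [set B]).
have mcylE B : B \in S -> m (@cylinder F n B) = (fine (m (@trunc_ker F n)))%:E.
  move=> /Strunc[x <-]; rewrite -lcoset_trunc_ker m_haar; last exact: (mcyl 1%:M).
  by rewrite fineK// fin_num_measure//; exact: (mcyl 1%:M).
rewrite measure_fin_bigcup//; last by move=> B C _ _ [x [<- <-]].
rewrite -(@bigfs _ _ _ _ (index_enum _)) ?index_enum_uniq//; last first.
  by move=> B _; rewrite mem_index_enum.
by rewrite (eq_bigr _ mcylE) sumEFin sumr_const mulr_natl.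
Qed.

Lemma measure_fiber n (mu : set (nat * nat)) (A : 'M[F]_n) :
  m [set x | trunc n x \in fiber (diag_positions n mu) A] =
  (q `^ (- #|diag_positions n mu|%:R))%:E.
Proof.
have q0 : 0 < q by apply: lt_trans q_gt1.
have mfiber nu : m [set x | trunc n x \in fiber (diag_positions n nu) A] =
    (q ^+ ('C(n, 2) - #|diag_positions n nu|) * fine (m (@trunc_ker F n)))%:E.
  rewrite measure_trunc; last exact: fiber_trunc.
  by rewrite card_fiber ?diag_positions_sub// natrX card_upper_positions.
(* For the empty diagram the fiber condition is vacuous: total mass 1 determines the mass of the
   kernel. *)
have := mfiber set0.
have -> : diag_positions n set0 = finset.set0.
  by apply/finset.setP => ij; rewrite !inE asboolF// andbF.
have -> : [set x | trunc n x \in fiber finset.set0 A] = [set: utmx F].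
  apply/seteqP; split => // x _ /=.
  have -> : finset.set0 = diag_positions n set0.
    by apply/finset.setP => ij; rewrite !inE asboolF// andbF.
  by apply/trunc_fiber.
rewrite probability_setT cards0 subn0 => -[one].
rewrite mfiber powRN powR_mulrn ?ltW//; congr (_%:E).
have le_card : (#|diag_positions n mu| <= 'C(n, 2))%N.
  by rewrite -card_upper_positions subset_leq_card// diag_positions_sub.
rewrite -[in LHS](mulfK (expf_neq0 #|diag_positions n mu| (lt0r_neq0 q0)) (q ^+ _)).
by rewrite -exprD subnK// mulrAC -one mul1r.
Qed.

Lemma measure_coset n x : m (lcoset x (@trunc_ker F n)) = (q `^ (- 'C(n, 2)%:R))%:E.
Proof.
rewrite -card_upper_positions upper_positionsE -(measure_fiber setT (trunc n x)).
rewrite lcoset_trunc_ker; congr (m _); apply/seteqP; split => y /=.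
  by move=> xy; apply/trunc_fiber => i j _ _; rewrite -xy mxE.
move=> /trunc_fiber yx; apply/matrixP => i j; rewrite mxE.
have [ij|ji|ij] := ltngtP i j; first exact: yx.
  by rewrite mxE !utfun_lower.
by rewrite mxE ij !utfun_diag.
Qed.

End Measure.

(** * Subadditivity over countable families and growth estimates *)

Lemma measure_le_esum d (T : measurableType d) (R : realType) (mu : {measure set T -> \bar R})
    (I : choiceType) (C : set I) (Q : I -> set T) :
  countable C -> (forall i, C i -> measurable (Q i)) ->
  [set: T] `<=` \bigcup_(i in C) Q i -> (mu [set: T] <= \esum_(i in C) mu (Q i))%E.
Proof.
move=> /countable_injP[c c_inj] mQ coverQ.
(* The union has at most one member, so [Q'] is the family carried to the natural numbers by [c] and
   empty off its image. *)
pose Q' k := \bigcup_(i in C `&` [set i | c i = k]) Q i.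
have Q'c i : C i -> Q' (c i) = Q i.
  move=> Ci; apply/seteqP; split=> [x [j [Cj /= /c_inj]]|x Qx]; last by exists i.
  by rewrite !inE => ->.
have Q'0 k : ~ (c @` C) k -> Q' k = set0.
  move=> ck; rewrite -subset0 => x [j [Cj cj] _].
  by case: ck; exists j.
have mQ' k : measurable (Q' k).
  have [[i Ci <-]|/Q'0->//] := pselect ((c @` C) k).
  by rewrite Q'c//; exact: mQ.
apply: (@le_trans _ _ (\sum_(0 <= k <oo) mu (Q' k))%E).
  apply: measure_sigma_subadditive => // x /coverQ[i Ci Qx].
  by exists (c i) => //; rewrite Q'c.
rewrite nneseries_esumT//.
rewrite (_ : \esum_(k in _) _ = \esum_(k in c @` C) mu (Q' k))%E.
  by rewrite esum_image//; apply: le_esum => i Ci; rewrite Q'c.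
rewrite [RHS]esum_mkcond; apply: eq_esum => k _; case: ifPn => //.
by rewrite notin_setE => /Q'0->; rewrite measure0.
Qed.

Lemma bin2_natr (R : realType) n : 'C(n, 2)%:R = n%:R * (n%:R - 1) / 2 :> R.
Proof.
elim: n => [|n IH]; first by rewrite bin0n mul0r mul0r.
by rewrite binS bin1 natrD IH -natr1; field.
Qed.

Lemma quadratic_growth (R : realType) (delta K L : R) : 0 < delta ->
  exists n0, forall n, (n0 <= n)%N -> L <= delta * 'C(n, 2)%:R - K * n%:R.
Proof.
(* For n >= b both L <= n and delta (n - 1) / 2 - K >= 1 hold; the product of n with the latter is
   the expression to bound. *)
move=> d0; pose b := `|L| + 2 * (`|K| + 1) / delta + 1.
have K0 : 0 <= 2 * (`|K| + 1) / delta by rewrite divr_ge0 ?mulr_ge0 ?addr_ge0// ltW.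
have b0 : 0 <= b by rewrite /b !addr_ge0.
exists (Num.bound b) => n; rewrite -(ler_nat R) => bn.
have {bn} bn : b <= n%:R by apply: le_trans bn; apply/ltW/archi_boundP.
have n0 : 0 <= n%:R :> R by [].
have Ln : L <= n%:R.
  apply: le_trans (ler_norm _) (le_trans _ bn); rewrite /b -addrA lerDl; lra.
have dn : 2 * (`|K| + 1) <= delta * (n%:R - 1).
  have -> : 2 * (`|K| + 1) = delta * (2 * (`|K| + 1) / delta).
    by rewrite [RHS]mulrC divfK// gt_eqF.
  rewrite ler_pM2l//; move: bn; rewrite /b; have := normr_ge0 L; lra.
have KK := ler_norm K.
apply: le_trans Ln _; rewrite bin2_natr.
have -> : delta * (n%:R * (n%:R - 1) / 2) - K * n%:R =
  n%:R * (delta * (n%:R - 1) / 2 - K) by field.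
by apply: ler_peMr => //; lra.
Qed.

Lemma powR_large (R : realType) (q T : R) : 1 < q ->
  exists L, forall t, L <= t -> T <= q `^ t.
Proof.
move=> q1; have lnq := ln_gt0 q1; exists (T / ln q) => t.
rewrite ler_pdivrMr// => Tt; rewrite /powR gt_eqF ?(lt_trans _ q1)//.
by apply: le_trans Tt (le_trans _ (expR_ge1Dx _)); rewrite lerDr.
Qed.

(** * Lower and upper bounds for the Hausdorff dimension *)

Section HausdorffBounds.
Variables (F : finFieldType) (R : realType) (m : probability (borel_utmx F) R).
Hypothesis m_haar : is_haar m.
Variables (mu : set (nat * nat)) (alpha K : R).
Implicit Types (M : set (utmx F)) (g : R).

Let q : R := #|F|%:R.

Let q_gt1 : 1 < q.
Proof. by rewrite ltr1n card_finNzRing_gt1. Qed.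

Let q_gt0 : 0 < q.
Proof. exact: lt_trans ltr01 q_gt1. Qed.

Let powD s t : q `^ (s + t) = q `^ s * q `^ t.
Proof. by rewrite powRD//; apply/implyP => _; rewrite gt_eqF. Qed.

(* Mass distribution: G is covered by the sets of matrices that agree on mu
   with an element of one of the cosets. *)
Lemma hausdorff_l_pinfty g M :
  (forall n, alpha * 'C(n, 2)%:R - K * n%:R <= #|diag_positions n mu|%:R) ->
  @partition_subgroup F mu `<=` M -> g < alpha -> hausdorff_l m g M = +oo%E.
Proof.
move=> mu_ge muM ga; apply: cvg_lim => //; apply/cvgeyPge => T.
have [L LT] := powR_large `|T| q_gt1.
have {}ga : 0 < alpha - g by rewrite subr_gt0.
have [n0 n0L] := quadratic_growth K L ga.
near=> theta.
(* Such a small [theta] forces every coset of the cover to have level at least [n0]. *)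
have theta_lt : theta < q `^ (- 'C(n0, 2)%:R).
  by near: theta; apply: nbhs_right_lt; rewrite powR_gt0.
apply: le_ereal_inf_tmp => _ [C [Ccoset Csmall Ccover] <-].
have /choice[c cP] (B : set (utmx F)) : exists nx : nat * utmx F,
    C B -> B = lcoset nx.2 (@trunc_ker F nx.1).
  have [/Ccoset[n [x [_ Bx]]]|] := pselect (C B); first by exists (n, x).
  by exists (0, 1%g).
pose Q B := [set y | trunc (c B).1 y \in
  fiber (diag_positions (c B).1 mu) (trunc (c B).1 (c B).2)].
have Ccount : countable C.
  exact: sub_countable (subset_card_le Ccoset) (countable_cosets F).
have mQ B : measurable (Q B : set (borel_utmx F)).
  exact: (@measurable_trunc F (c B).1 [set A | A \in fiber _ _]).
have Qcover : [set: borel_utmx F] `<=` \bigcup_(B in C) Q B.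
  (* [z] is [y] with the entries outside [mu] erased; it lies in the partition subgroup, so some
     coset of the cover contains it. *)
  move=> y _; pose z := unitri (fun i j => if `[< mu (i, j) >] then y i j else 0).
  have zE i j : (i < j)%N -> z i j = if `[< mu (i, j) >] then y i j else 0.
    by move=> ij; rewrite /z/= /unitri_fun ij.
  have /muM/Ccover[B CB Bz] : partition_subgroup mu z.
    by move=> i j ij muij; rewrite zE// asboolF.
  exists B => //; move: Bz; rewrite {1}(cP _ CB) lcoset_trunc_ker => /matrixP zB.
  apply/trunc_fiber => i j ij muij; rewrite -zB mxE zE// asboolT//.
(* Scaling [m] to total mass |T| reduces the claim to a termwise comparison of the mass of [Q B]
   with the weight of [B]. *)
have : (`|T|%:E * m [set: borel_utmx F] <= \esum_(B in C) (`|T|%:E * m (Q B)))%E :=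
  measure_le_esum (mscale (NngNum (normr_ge0 T)) m) Ccount (fun B _ => mQ B) Qcover.
rewrite probability_setT mule1 => le_sum.
apply: (@le_trans _ _ (`|T|%:E)%E); first by rewrite lee_fin ler_norm.
apply: le_trans le_sum _; apply: le_esum => B CB.
have mB : m B = (q `^ (- 'C((c B).1, 2)%:R))%:E.
  by rewrite {1}(cP _ CB) (measure_coset m_haar).
rewrite (measure_fiber m_haar) mB poweR_EFin -powRrM -EFinM lee_fin.
move: (Csmall _ CB); rewrite mB lte_fin.
move: (c B).1 => n n_theta.
have n0n : (n0 <= n)%N.
  rewrite leqNgt; apply/negP => nn0.
  have := lt_trans n_theta theta_lt; apply/negP; rewrite -leNgt.
  by rewrite ler_powR ?(ltW q_gt1)// lerN2 ler_nat leq_bin2l// ltnW.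
apply: le_trans (ler_wpM2r (powR_ge0 _ _) (LT _ (n0L _ n0n))) _.
rewrite -powD ler_powR ?(ltW q_gt1)//.
by have := mu_ge n; lra.
Unshelve. all: by end_near. Qed.

Lemma card_diag_positionsC n :
  #|diag_positions n (~` mu)| = ('C(n, 2) - #|diag_positions n mu|)%N.
Proof.
rewrite -card_upper_positions -cardsDS ?diag_positions_sub//; congr #|pred_of_set _|.
by apply/finset.setP => ij; rewrite !inE asbool_neg; case: (_ < _)%N; rewrite ?andbF ?andbT.
Qed.

(** With a_n positions of [mu] below size n, the q^a_n cosets of a single N_n cover [M] with total
    weight q^(a_n - g 'C(n, 2)), which tends to 0. *)
Lemma hausdorff_l0 g M :
  (forall n, #|diag_positions n mu|%:R <= alpha * 'C(n, 2)%:R + K * n%:R) ->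
  M `<=` @partition_subgroup F mu -> alpha < g -> hausdorff_l m g M = 0%E.
Proof.
move=> mu_le Mmu ag; apply: cvg_lim => //; apply: cvg_near_cst.
near=> theta; have theta0 : 0 < theta by near: theta; exact: nbhs_right_gt.
apply/eqP; rewrite eq_le; apply/andP; split; last first.
  by apply: le_ereal_inf_tmp => _ [C _ <-]; apply: esum_ge0 => B _; exact: poweR_ge0.
apply/lee_addgt0Pr => eps eps0; rewrite add0e.
have [L1 L1P] := powR_large eps^-1 q_gt1.
(* The added 1 makes the masses strictly smaller than [theta]. *)
have [L2 L2P] := powR_large (theta^-1 + 1) q_gt1.
have {}ag : 0 < g - alpha by rewrite subr_gt0.
have [n1 n1P] := quadratic_growth K L1 ag.
have [n2 n2P] := quadratic_growth 0 L2 (@ltr01 R).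
(* The successor provides the positive level that [is_coset] requires. *)
pose n := (n1 + n2).+1.
have {}n1P := n1P n (leqW (leq_addr _ _)).
have {}n2P := n2P n (leqW (leq_addl _ _)).
pose S := fiber (diag_positions n (~` mu)) (1%:M : 'M[F]_n).
have card_S : #|S| = (#|F| ^ #|diag_positions n mu|)%N.
  rewrite card_fiber ?diag_positions_sub// card_upper_positions card_diag_positionsC.
  by rewrite subKn// -card_upper_positions subset_leq_card// diag_positions_sub.
have m_cyl A : A \in S -> m (@cylinder F n A) = (q `^ (- 'C(n, 2)%:R))%:E.
  by move=> /fiber_trunc[x <-]; rewrite -lcoset_trunc_ker (measure_coset m_haar).
apply: (@le_trans _ _ (\esum_(B in @cylinder F n @` [set` S]) poweR (m B) g)%E).
  apply: ereal_inf_lbound; exists (@cylinder F n @` [set` S]) => //; split.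
  - move=> _ [A AS <-]; have [x xA] := fiber_trunc AS.
    by exists n, x; split => //; rewrite lcoset_trunc_ker xA.
  - move=> _ [A AS <-]; rewrite (m_cyl _ AS) lte_fin powRN.
    rewrite invf_plt ?posrE ?powR_gt0//; apply: lt_le_trans (L2P _ _).
      by rewrite ltrDl.
    by move: n2P; rewrite mul1r mul0r subr0.
  - move=> x /Mmu xmu; exists (cylinder (trunc n x)) => //.
    exists (trunc n x) => //; apply/trunc_fiber => i j ij muij.
    by rewrite xmu// mxE -val_eqE/= (ltn_eqF ij).
(* Cylinders over distinct elements of [S] are nonempty and distinct, so the sum can run over
   [S]. *)
rewrite esum_image; last first.
  move=> A B; rewrite !inE/= => /fiber_trunc[x <-] _ xB.
  by have : cylinder (trunc n x) x by []; rewrite xB.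
rewrite esum_fset//; last by move=> A _; exact: poweR_ge0.
rewrite -(@bigfs _ _ _ _ (index_enum _)) ?index_enum_uniq//; last first.
  by move=> A _; rewrite mem_index_enum.
rewrite (eq_bigr (fun=> (q `^ (- 'C(n, 2)%:R * g))%:E)); last first.
  by move=> A AS; rewrite m_cyl// poweR_EFin -powRrM.
rewrite sumEFin sumr_const card_S lee_fin -[leLHS]mulr_natl natrX.
rewrite -powR_mulrn ?(ltW q_gt0)// -powD.
apply: (@le_trans _ _ (q `^ (- ((g - alpha) * 'C(n, 2)%:R - K * n%:R)))).
  by rewrite ler_powR ?(ltW q_gt1)//; have := mu_le n; lra.
by rewrite powRN invf_ple ?posrE ?powR_gt0//; exact: L1P.
Unshelve. all: by end_near. Qed.

End HausdorffBounds.

(** * Dimensions of partition subgroups, the two series and the spectrum *)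

Lemma has_dim_partition (F : finFieldType) (R : realType) (m : probability (borel_utmx F) R)
    (mu : set (nat * nat)) (alpha K : R) : is_haar m ->
  (forall n, `|#|diag_positions n mu|%:R - alpha * 'C(n, 2)%:R| <= K * n%:R) ->
  has_dim m (@partition_subgroup F mu) alpha.
Proof.
move=> m_haar mu_approx; split=> g ?.
  apply: (hausdorff_l_pinfty m_haar (mu := mu) (alpha := alpha) (K := K)) => // n.
  by move: (mu_approx n); rewrite ler_norml; lra.
apply: (hausdorff_l0 m_haar (mu := mu) (alpha := alpha) (K := K)) => // n.
by move: (mu_approx n); rewrite ler_norml; lra.
Qed.

(** The full diagram gives the whole group, with exactly 'C(n, 2) positions. *)
Lemma hausdorff_l0_gt1 (F : finFieldType) (R : realType) (m : probability (borel_utmx F) R)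
    (g : R) (M : set (utmx F)) : is_haar m -> 1 < g -> hausdorff_l m g M = 0%E.
Proof.
move=> m_haar; apply: (hausdorff_l0 m_haar (mu := setT) (K := 0)) => [n|x _ i j _ []//].
by rewrite -upper_positionsE card_upper_positions mul1r mul0r addr0.
Qed.

Lemma has_dim_band (F : finFieldType) (R : realType) (m : probability (borel_utmx F) R)
    (d : nat) (M : set (utmx F)) : is_haar m ->
  @partition_subgroup F (band d) `<=` M -> has_dim m M 1.
Proof.
move=> m_haar dM; split=> g; last exact: hausdorff_l0_gt1.
apply: (hausdorff_l_pinfty m_haar (mu := band d) (K := d%:R)) => // n.
by rewrite mul1r lerBlDr -natrM -natrD ler_nat card_band.
Qed.

Theorem theorem8p2 (p f : nat) (F : finFieldType) (R : realType)
    (m : probability (borel_utmx F) R)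
    (p_prime : prime p) (p_odd : odd p) (f_ge1 : (1 <= f)%N)
    (cardF : #|F| = (p ^ f)%N) (m_haar : is_haar m) :
  [/\ forall alpha : R, 0 <= alpha <= 1 ->
        exists mu : set (nat * nat),
          partition_diagram mu /\ has_dim m (@partition_subgroup F mu) alpha,
      Spec m = `[0, 1]%classic &
      forall d : nat, (1 <= d)%N ->
        has_dim m (@lower_central F d) 1 /\ has_dim m (@derived_series F d) 1].
Proof.
have dim_mu (alpha : R) : 0 <= alpha <= 1 -> exists mu : set (nat * nat),
    partition_diagram mu /\ has_dim m (@partition_subgroup F mu) alpha.
  move=> alpha01; exists (greedy_diagram alpha); split.
    exact: greedy_diagram_partition.
  apply: (@has_dim_partition _ _ _ _ _ 1) => // n.
  by rewrite card_greedy_diagram mul1r greedy_total_approx.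
split=> //; last first.
  move=> d d0; split; first exact/has_dim_band/lower_central_band.
  exact/has_dim_band/derived_series_band.
apply/seteqP; split=> [a [H [[H1 _] _ [lo hi]]]|a].
  rewrite /= in_itv/=; apply/andP; split; rewrite leNgt; apply/negP => a_lt.
    (* If a < 0, then a / 2 lies strictly between a and 0, yet the trivial subgroup, of the empty
       diagram, forces the value +oo at negative exponents. *)
    have : hausdorff_l m (a / 2) H = 0%E by apply: hi; lra.
    rewrite (hausdorff_l_pinfty m_haar (mu := set0) (alpha := 0) (K := 0))//; last by lra.
      by move=> n; rewrite !mul0r subr0.
    move=> x x0; suff -> : x = 1%g by move: H1; rewrite inE.
    apply: utmxP => i j; have [ij|ji|->] := ltngtP i j; last by rewrite !utfun_diag.
      by rewrite x0// /= /ut1fun (ltn_eqF ij).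
    by rewrite !utfun_lower.
  (* If a > 1, the midpoint of 1 and a is an exponent above 1, where the value is 0. *)
  have : hausdorff_l m ((1 + a) / 2) H = +oo%E by apply: lo; lra.
  by rewrite hausdorff_l0_gt1//; lra.
rewrite /= in_itv/= => /dim_mu[mu [mu_diag mu_dim]].
exists (@partition_subgroup F mu); split => //.
  exact: partition_subgroup_group.
exact: partition_subgroup_closed.
Qed.
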